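(* Let $p>3$ be a prime, let $G$ be the additive group $(\mathbb{Z}/p\mathbb{Z})^2$, and let $S_1=\{(x,x^3): x\in\mathbb{Z}/p\mathbb{Z}\}\subseteq G$. Then the cop number of the undirected Cayley graph $\mathrm{Cay}(G,S_1)$ is exactly $\left\lceil \tfrac12 p\right\rceil=\left\lceil \tfrac12\sqrt{|G|}\right\rceil$.
   Context: Cops and robbers is played on a finite connected graph. First each cop chooses a starting vertex, then the robber chooses a starting vertex. Then cop turns and robber turns alternate, starting with a cop turn. On a cop turn each cop moves to a neighbouring vertex or stays where it is; on a robber turn the robber does likewise. Several cops may share a vertex, and all players have full information. The cops win if at some point a cop shares a vertex with the robber; the robber wins if this never happens. The cop number is the minimum number of cops for which the cops have a winning strategy. $\mathrm{Cay}(G,S_1)$ is the graph with vertex set $G$ in which $u,v$ are adjacent iff $v-u\in S_1$; since $S_1=-S_1$ it is regarded as undirected. Here $0_G\in S_1$ is allowed: choosing the move $0_G$ simply means staying in place, so the game is the same as on the graph with connection set $S_1\setminus\{0_G\}$. The set $S_1$ generates $G$. *)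

(* Defs.v *)
From HB Require Import structures.
From mathcomp Require Import all_boot all_order all_algebra.
From mathcomp Require Import boolp reals.

Set Implicit Arguments.
Unset Strict Implicit.
Unset Printing Implicit Defensive.

Import GRing.Theory.
Local Open Scope ring_scope.

Section CopsAndRobbers.
Variables (T : finType) (e : rel T).

Definition move : rel T := fun u v => (u == v) || e u v.

(* [s h] is the position of the k cops once they have answered the successive
   robber positions listed in [h]; [s [::]] is their initial placement.  The
   earlier cop positions are determined by [s], so the robber's history is all
   the information that a strategy can depend on. *)
Definition cop_strategy (k : nat) := seq T -> {ffun 'I_k -> T}.

Definition legal_strategy (k : nat) (s : cop_strategy k) : Prop :=
  forall (h : seq T) (v : T) (i : 'I_k), move (s h i) (s (rcons h v) i).

Definition robber_play (r : nat -> T) : Prop := forall n, move (r n) (r n.+1).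

(* [r n] is the robber's position after n robber turns, and [s (mkseq r n)]
   that of the cops after n cop turns.  A capture happens either when the robber
   is placed or moves (first disjunct), or on the next cop turn (second). *)
Definition captures (k : nat) (s : cop_strategy k) (r : nat -> T) : Prop :=
  exists (n : nat) (i : 'I_k),
    s (mkseq r n) i = r n \/ s (mkseq r n.+1) i = r n.

Definition cops_win (k : nat) : Prop :=
  exists2 s : cop_strategy k, legal_strategy s &
    forall r, robber_play r -> captures s r.

Lemma cops_win_card : exists k, `[< cops_win k >].
Proof.
exists #|T|; apply/asboolP; exists (fun=> [ffun i => enum_val i]).
  by move=> h v i; rewrite /move eqxx.
by move=> r _; exists 0%N, (enum_rank (r 0%N)); left; rewrite ffunE enum_rankK.
Qed.

Definition cop_number : nat := ex_minn cops_win_card.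

End CopsAndRobbers.

Definition Cay (A : finZmodType) (S : {set A}) : rel A :=
  fun u v => v - u \in S.

(* The library does not declare products of finite abelian groups as such. *)
HB.instance Definition _ (A B : finZmodType) := GRing.Zmodule.on (A * B)%type.

Definition G (p : nat) : finZmodType := ('F_p * 'F_p)%type.

Definition S1 (p : nat) : {set G p} := [set ((x, x ^+ 3) : G p) | x : 'F_p].

(* Main.v *)
Require Import Defs.
From mathcomp Require Import all_boot all_order all_algebra.
From mathcomp Require Import boolp reals.
From mathcomp Require Import ring lra zify.

(** Write s_x = (x, x^3) for the p possible moves.

    Lower bound: for a nonzero difference d between the robber and a cop, the
    moves s_x after which this cop can capture are the roots of
    (d_1 + x)^3 = d_2 + x^3, which is quadratic in x unless it has no solution.
    Each cop guards at most two of the p moves, so 2k < p cops are evaded.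

    Upper bound (Frankl's argument): give a cop a pair (a, b) with a + b <> 0.
    Once its difference d to the robber lies on the line spanned by s_a + s_b,
    answering s_a by - s_b and s_b by - s_a moves d along the line in equal
    steps, so the robber can play s_a and s_b only finitely often.  To bring
    one more cop onto its line, defined by f = 0, the u remaining cops share
    out the at most 2u - 1 moves not yet guarded, each being in charge of at
    most two moves, both of which it can answer so that f(d) changes by the
    same nonzero amount.  The robber always plays a move that some cop is in
    charge of, so eventually some f(d) vanishes. *)

Set Implicit Arguments.
Unset Strict Implicit.
Unset Printing Implicit Defensive.

Import Order.TTheory GRing.Theory Num.Theory.
Local Open Scope ring_scope.

(** * Bounded wins on differences, and the cop strategies they yield *)

Section Differences.
Variables (A : finZmodType) (S : {set A}) (k : nat).
Hypothesis S0 : 0 \in S.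
Implicit Types (D t : {ffun 'I_k -> A}) (s : A) (n : nat).

Definition shift D s t : {ffun 'I_k -> A} := [ffun i => D i + s - t i].

Definition legal t := [forall i, t i \in S].

(* [D i] is the robber's position minus that of cop [i], the robber being to
   move; [wins n D] says that the cops can capture within [n] rounds. *)
Fixpoint wins n D : bool :=
  [exists i, D i == 0] ||
  (if n is m.+1 then
     [forall s in S, exists t, legal t && wins m (shift D s t)]
   else false).

Definition escapes D := forall n, ~~ wins n D.

Lemma winsS n D : wins n D -> wins n.+1 D.
Proof.
elim: n D => [|n IH] D; first by rewrite /= orbF => ->.
move=> /orP[caught|/forall_inP win]; first by rewrite /= caught.
apply/orP; right; apply/forall_inP => s /win /existsP[t /andP[tS wt]].
by apply/existsP; exists t; apply/andP; split=> //; apply: IH.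
Qed.

Lemma wins_leq m n D : (m <= n)%N -> wins m D -> wins n D.
Proof.
move=> /subnK <-; elim: (n - m)%N => //= j IH /IH; exact: winsS.
Qed.

Lemma escapes_neq0 D i : escapes D -> D i != 0.
Proof.
move=> /(_ 0%N) /=; rewrite orbF negb_exists; exact: (fun h => forallP h i).
Qed.

(** The robber has finitely many moves: if each had a winning answer, the largest of the bounds
    would give a bounded win from [D]. *)
Lemma escapes_step D : escapes D ->
  exists2 s, s \in S & forall t, legal t -> escapes (shift D s t).
Proof.
move=> esc; apply: contrapT => nesc.
have /fin_all_exists[tn win] : forall s, exists tn : {ffun 'I_k -> A} * nat,
    s \in S -> legal tn.1 && wins tn.2 (shift D s tn.1).
  move=> s; apply: contrapT => nwin; apply: nesc; exists s.
    by apply: contrapT => sS; apply: nwin; exists ([ffun=> 0], 0%N).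
  move=> t tS n; apply/negP => wt; apply: nwin; exists (t, n) => _.
  by rewrite tS.
have /negP := esc (\max_s (tn s).2).+1; apply; apply/orP; right.
apply/forall_inP => s /win /andP[tS wt]; apply/existsP; exists (tn s).1.
apply/andP; split=> //; apply: wins_leq wt; exact: (leq_bigmax s).
Qed.

(* The bound [n] decreases along the play; without it, replies that merely stay
   in winning positions could cycle. *)
Definition reply n D s : {ffun 'I_k -> A} :=
  odflt [ffun=> 0] [pick t | legal t && wins n (shift D s t)].

Lemma legal_reply n D s : legal (reply n D s).
Proof.
rewrite /reply; case: pickP => [t /andP[]//|_] /=.
by apply/forallP => i; rewrite ffunE.
Qed.

Lemma wins_reply n D s : s \in S -> wins n.+1 D -> ~~ [exists i, D i == 0] ->
  wins n (shift D s (reply n D s)).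
Proof.
move=> sS /orP[->//|/forall_inP/(_ s sS)/existsP[t wt] _].
by rewrite /reply; case: pickP => [t' /andP[]//|/(_ t)]; rewrite wt.
Qed.

Definition pursue (st : {ffun 'I_k -> A} * A * nat) v :=
  let: (C, w, n) := st in
  let t := reply n.-1 [ffun i => w - C i] (v - w) in
  ([ffun i => C i + t i], v, n.-1).

(** The cops wait at 0 on their first turn, so the pursuit starts with the robber to move and all
    differences equal to its starting vertex. *)
Definition pursuit (N : A -> nat) : cop_strategy A k := fun h =>
  if h is v :: h' then (foldl pursue ([ffun=> 0], v, N v) h').1.1
  else [ffun=> 0].

Lemma legal_pursuit N : legal_strategy (Cay S) (pursuit N).
Proof.
case=> [|w h] v i; first by rewrite /move eqxx.
rewrite /= foldl_rcons /move /Cay; case: foldl => [[C u] n] /=.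
by rewrite !ffunE addrAC subrr add0r (forallP (legal_reply _ _ _)) orbT.
Qed.

Lemma wins_cops_win : (forall D, exists n, wins n D) -> cops_win (Cay S) k.
Proof.
move=> win; pose start v : {ffun 'I_k -> A} := [ffun=> v].
have /fin_all_exists[N winN] : forall v, exists n, wins n (start v) by [].
exists (pursuit N) => [|r rP]; first exact: legal_pursuit.
apply: contrapT => ncap.
have rS n : r n.+1 - r n \in S.
  by case/orP: (rP n) => [/eqP ->|//]; rewrite subrr.
pose st n := foldl pursue ([ffun=> 0], r 0%N, N (r 0%N))
  (map r (iota 1 n)).
have stE n : pursuit N (mkseq r n.+1) = (st n).1.1 by [].
have stS n : st n.+1 = pursue (st n) (r n.+1).
  by rewrite /st -{1}(addn1 n) iotaD map_cat foldl_cat.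
have [st2 st3] : (forall n, (st n).1.2 = r n) /\
    (forall n, (st n).2 = N (r 0%N) - n)%N.
  split; elim=> [|n IH]; rewrite ?subn0 // stS.
    by case: (st n) => [[]].
  by rewrite subnS -IH; case: (st n) => [[]].
have ncaught n : ~~ [exists i, [ffun i => r n - (st n).1.1 i] i == 0].
  apply/negP => /existsP[i]; rewrite ffunE subr_eq0 => /eqP cap.
  by apply: ncap; exists n, i; right; rewrite stE.
have inv n : (n <= N (r 0%N))%N ->
    wins (N (r 0%N) - n) [ffun i => r n - (st n).1.1 i].
  elim: n => [_|n IH nN].
    rewrite subn0.
    suff -> : [ffun i => r 0%N - (st 0%N).1.1 i] = start (r 0%N) by [].
    by apply/ffunP => i; rewrite !ffunE subr0.
  have := IH (ltnW nN); rewrite -(subnSK nN).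
  move=> /(wins_reply (rS n)) /(_ (ncaught n)); set D' := shift _ _ _.
  suff -> : [ffun i => r n.+1 - (st n.+1).1.1 i] = D' by [].
  apply/ffunP => i; rewrite {}/D' stS.
  move: (st2 n) (st3 n); case: (st n) => [[C w] m] /= -> ->.
  rewrite !ffunE -subnS opprD addrA; congr (_ - _).
  by rewrite [RHS]addrAC (addrC (r n)) subrK.
have := inv _ (leqnn _); rewrite subnn /= orbF.
exact/negP.
Qed.

End Differences.

(** * Evasion criterion and counting bound *)

(** The robber always picks a vertex that no cop reaches on its next turn. As [sg] fixes the cops'
    replies, the choice depends on the robber's own history alone. *)
Lemma robber_evades (A : finZmodType) (S : {set A}) (k : nat) : 0 \in S ->
  (forall C : {ffun 'I_k -> A}, exists v, forall i, v - C i \notin S) ->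
  (forall (C : {ffun 'I_k -> A}) v, (forall i, C i != v) ->
     exists2 s, s \in S & forall i, v + s - C i \notin S) ->
  ~ cops_win (Cay S) k.
Proof.
move=> S0 start step [sg sgP win].
pose safe h v := [forall i, v - sg h i \notin S].
pose ok h v := safe h v &&
  (if h is w :: h' then move (Cay S) (last w h') v else true).
pose next h := odflt 0 [pick v | ok h v].
pose hist n := iter n (fun h => rcons h (next h)) [::].
pose r n := next (hist n).
have histE n : mkseq r n = hist n.
  by elim: n => // n IH; rewrite mkseqS IH.
have okP h : (exists v, ok h v) -> ok h (next h).
  by case=> v okv; rewrite /next; case: pickP => // /(_ v); rewrite okv.
have stay h v i : safe h v -> sg (rcons h v) i != v.
  move=> /forallP/(_ i); apply: contraNneq => vE.
  have := sgP h v i; rewrite vE /move /Cay.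
  by case/orP => [/eqP ->|//]; rewrite subrr.
have inv n : ok (hist n) (r n).
  elim: n => [|n /andP[sf _]]; apply: okP.
    have [v vP] := start (sg [::]); exists v.
    by rewrite /ok andbT; apply/forallP.
  have [s sS sP] := step _ _ (stay _ _ ^~ sf); exists (r n + s).
  apply/andP; split; first exact/forallP.
  rewrite /= -/(r n); case E: (rcons _ _) => [|w h']; first by case: (hist n) E.
  have -> : last w h' = r n by rewrite -(last_cons w) -E last_rcons.
  by rewrite /move /Cay addrAC subrr add0r sS orbT.
have rP : robber_play (Cay S) r.
  move=> n; have /andP[_] := inv n.+1; rewrite /= -/(r n).
  case E: (rcons _ _) => [|w h']; first by case: (hist n) E.
  by rewrite -(last_cons w w) -E last_rcons.
have [n [i]] := win r rP; rewrite !histE.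
have /andP[sf _] := inv n.
case=> [E|/eqP]; last by apply/negP; apply: stay.
by have /forallP/(_ i) := sf; rewrite E subrr S0.
Qed.

Lemma cover_escape (T : finType) (k m : nat) (B : 'I_k -> {set T}) :
  (forall i, #|B i| <= m)%N -> (k * m < #|T|)%N ->
  exists x, forall i, x \notin B i.
Proof.
move=> Bm kT; suff /existsP[x /forallP xP] : [exists x, forall i, x \notin B i].
  by exists x.
apply: contraTT kT; rewrite negb_exists -leqNgt => /forallP cov.
have -> : #|T| = #|\bigcup_i B i|.
  rewrite -cardsT; apply: eq_card => x; rewrite inE; apply/esym/bigcupP.
  by have := cov x; rewrite negb_forall => /existsP[i]; rewrite negbK; exists i.
apply: leq_trans (_ : \sum_(i < k) #|B i| <= _)%N.
  elim/big_ind2: _ => [|A a C c Aa Cc|//]; first by rewrite cards0.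
  exact: leq_trans (leq_card_setU _ _) (leq_add Aa Cc).
by rewrite -[k in (k * m)%N]card_ord -sum_nat_const leq_sum.
Qed.

(** * Guarded moves and the lower bound *)

Section Cubic.
Variable p : nat.
Hypotheses (p_prime : prime p) (p_gt3 : (3 < p)%N).
Local Notation F := 'F_p.
Implicit Types (x y z a b m : F) (c d : G p).

Definition cub x : G p := (x, x ^+ 3).

Lemma mem_S1 d : (d \in S1 p) = (d.2 == d.1 ^+ 3).
Proof.
apply/imsetP/eqP => [[x _ ->//]|E]; exists d.1 => //.
by rewrite -E; case: d {E}.
Qed.

Lemma S1_0 : 0 \in S1 p. Proof. by rewrite mem_S1 /= expr0n. Qed.

Lemma natr_Fp_neq0 n : (0 < n < p)%N -> n%:R != 0 :> F.
Proof.
move=> /andP[n0 np]; rewrite -(dvdn_pcharf (pchar_Fp p_prime)).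
by apply/negP => /(dvdn_leq n0); rewrite leqNgt np.
Qed.

Lemma card_guarded d : d != 0 ->
  (#|[set x | d + cub x \in S1 p]%R| <= 2)%N.
Proof.
move=> d0; case: (set_0Vmem [set x | d + cub x \in S1 p]) => [->|[x]].
  by rewrite cards0.
rewrite inE mem_S1 /= => /eqP xP.
apply: leq_trans (_ : #|[set x; - d.1 - x]%R| <= 2)%N; last first.
  by rewrite cards2; case: eqP.
apply/subset_leq_card/subsetP => y; rewrite !inE mem_S1 /= => /eqP yP.
have d1 : d.1 != 0.
  apply: contra_neq d0 => d1; move: xP; rewrite d1 add0r => /(canRL (addrK _)).
  by rewrite subrr; case: d d1 {yP} => u v /= -> ->.
(* Subtracting the equations for [x] and [y] leaves a product; 3 is invertible as p > 3, so [y] is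
   [x] or [- d.1 - x]. *)
have : 3%:R * d.1 * ((y - x) * (y + d.1 + x)) = 0.
  have -> : 3%:R * d.1 * ((y - x) * (y + d.1 + x)) =
    ((d.1 + y) ^+ 3 - y ^+ 3) - ((d.1 + x) ^+ 3 - x ^+ 3) by ring.
  by rewrite -xP -yP; ring.
move/eqP; rewrite !mulf_eq0 (negPf d1) (negPf (natr_Fp_neq0 _)) //=.
rewrite subr_eq0 => /orP[->//|]; rewrite -addrA addr_eq0 opprD => ->.
by rewrite orbT.
Qed.

Lemma not_cops_win k : (k * 2 < p)%N -> ~ cops_win (Cay (S1 p)) k.
Proof.
move=> kp; apply: robber_evades S1_0 _ _ => [C|C v vP].
  (* The robber starts at some [(0, y)]; each cop guards exactly one of these. *)
  have [||y yP] := @cover_escape F k 1%N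
      (fun i => [set (C i).2 - (C i).1 ^+ 3]).
  - by move=> i; rewrite cards1.
  - by rewrite card_Fp // muln1; lia.
  exists ((0, y) : G p) => i; have := yP i; rewrite !inE mem_S1 /=.
  apply: contra => /eqP E; rewrite -(subr_eq0) opprB addrA addrAC E.
  by apply/eqP; ring.
have [||x xP] := @cover_escape F k 2
    (fun i => [set x | v - C i + cub x \in S1 p]).
- by move=> i; apply: card_guarded; rewrite subr_eq0 eq_sym.
- by rewrite card_Fp.
exists (cub x); first by rewrite mem_S1.
by move=> i; have := xP i; rewrite inE addrAC.
Qed.

(** * Steering by linear functionals *)

Definition lin c d : F := c.1 * d.1 + c.2 * d.2.

Lemma lin_shift c d s t : lin c (d + s - t) = lin c d + lin c (s - t).
Proof. by rewrite /lin /=; ring. Qed.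

Lemma linB c s t : lin c (s - t) = lin c s - lin c t.
Proof. by rewrite /lin /=; ring. Qed.

Lemma lin0 c : lin c 0 = 0.
Proof. by rewrite /lin /= !mulr0 addr0. Qed.

Lemma lin0l d : lin 0 d = 0.
Proof. by rewrite /lin /= !mul0r addr0. Qed.

(* Every robber move brings the value of [l i] closer to 0, in steps of 1, for
   some cop [i] and never changes the values of [q i]. *)
Lemma steer k (l q : 'I_k -> G p) (tau : 'I_k -> F -> F) D :
  (forall i x, tau i x != x ->
     lin (l i) (cub x - cub (tau i x)) = 1 /\
     lin (q i) (cub x - cub (tau i x)) = 0) ->
  (forall x, exists i, tau i x != x) ->
  escapes (S1 p) D ->
  exists2 D', escapes (S1 p) D' &
    (forall i, lin (q i) (D' i) = lin (q i) (D i)) /\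
    exists i, lin (l i) (D' i) = 0.
Proof.
move=> tauP tau_all esc.
(* [n i] counts the unit steps that cop [i] still needs; the induction is on their sum. *)
pose n i : nat := - lin (l i) (D i).
have nP i : lin (l i) (D i) = - (n i)%:R by rewrite natr_Zp opprK.
move: {2}(\sum_i n i)%N (leqnn (\sum_i n i)%N) => N.
elim: N D n nP esc => [|N IH] D n nP esc sumN.
all: have [/existsP[i /eqP ni0]|/existsPn npos] := boolP [exists i, n i == 0%N].
- by exists D => //; split=> //; exists i; rewrite nP ni0 oppr0.
- have [i _] := tau_all 0; case/negP: (npos i).
  by rewrite -leqn0; apply: leq_trans sumN; rewrite (bigD1 i) //= leq_addr.
- by exists D => //; split=> //; exists i; rewrite nP ni0 oppr0.
(* Where [tau i x = x], the cop copies the robber and [D i] is unchanged. *)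
have [_ /imsetP[x _ ->] /(_ [ffun i => cub (tau i x)])] := escapes_step esc.
set D' := shift _ _ _ => escD'.
have moved c i : lin c (D' i) = lin c (D i) + lin c (cub x - cub (tau i x)).
  by rewrite !ffunE lin_shift.
have [|||D2 e2 [q2 l2]] := IH D' (fun i => n i - (tau i x != x))%N.
- move=> i; rewrite moved nP; have [E|/tauP[-> _]] := eqVneq (tau i x) x.
    by rewrite E subrr lin0 addr0 subn0.
  by rewrite natrB ?lt0n // opprB addrC.
- by apply: escD'; apply/forallP => i; rewrite ffunE mem_S1.
- have [i ix] := tau_all x; rewrite -ltnS; apply: leq_trans sumN.
  rewrite (bigD1 i) //= [X in (_ < X)%N](bigD1 i) //= ix -addSn.
  by rewrite leq_add ?leq_sum => // [|j _];
    rewrite ?leq_subr // subn1 prednK ?lt0n.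
exists D2 => //; split=> // i; rewrite q2 moved.
have [E|/tauP[_ ->]] := eqVneq (tau i x) x; last by rewrite addr0.
by rewrite E subrr lin0 addr0.
Qed.

(** * Sharing out the unguarded moves *)

(** One cop can be in charge of all moves in [X], with [t x] as the answer to [x]. *)
Definition steerable (f : F -> F) (X : {set F}) :=
  exists g, exists t : F -> F, g != 0 /\ {in X, forall x, f x - f (t x) = g}.

Lemma steerable_peel f u (U : {set F}) :
  (forall x, exists t, f t != f x) -> (forall x, f (- x) = - f x) ->
  (#|U| <= u.*2.+1)%N ->
  exists2 Y, steerable f Y & (#|U :\: Y| <= u.*2.-1)%N.
Proof.
move=> nconst odd_f Uu.
have same (Y : {set F}) x : {in Y, forall y, f y = f x} -> steerable f Y.
  move=> Yx; have [t tx] := nconst x; exists (f x - f t), (fun=> t).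
  by rewrite subr_eq0 eq_sym; split=> // y /Yx ->.
(* Equal values allow one fixed answer. Otherwise [x] is answered by [- y] and [y] by [- x], both
   with step [f x + f y]. *)
have pair x y : f x = f y \/ f x + f y != 0 -> steerable f [set x; y].
  case=> [xy|nz]; first by apply: (same _ y) => z /set2P[] ->.
  exists (f x + f y), (fun z => if z == x then - y else - x); split=> // z.
  move=> /set2P[] ->; first by rewrite eqxx odd_f opprK.
  by case: eqP => [->|_]; rewrite odd_f opprK // addrC.
have peel2 x y : x \in U -> y \in U -> x != y ->
    f x = f y \/ f x + f y != 0 ->
    exists2 Y, steerable f Y & (#|U :\: Y| <= u.*2.-1)%N.
  move=> xU yU xy /pair xyP; exists [set x; y] => //.
  have sub : [set x; y] \subset U by apply/subsetP => z /set2P[] ->.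
  by rewrite cardsDS // cards2 xy; lia.
(* Of three moves some two qualify: if [f x + f y] and [f z + f x] vanish, then [f y = f z]. *)
have [/card_gt2P[x [y [z [[xU yU zU] [xy yz zx]]]]]|U2] := boolP (2 < #|U|)%N.
  have [Exy|nxy] := eqVneq (f x + f y) 0; last by apply: (peel2 x y); auto.
  have [Ezx|nzx] := eqVneq (f z + f x) 0; last by apply: (peel2 z x); auto.
  apply: (peel2 y z) => //; left; apply: (addrI (f x)).
  by rewrite Exy addrC Ezx.
have [->|[x xU]] := set_0Vmem U.
  exists set0; last by rewrite setD0 cards0.
  by apply: (same _ 0) => y; rewrite inE.
exists [set x]; first by apply: (same _ x) => y /set1P ->.
by move: U2 Uu; rewrite (cardsD1 x) xU; lia.
Qed.

(** Each cop in turn peels off one steerable set; by truncated subtraction, [U] is empty once no cop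
    is left. *)
Lemma steerable_cover f k (U : {set F}) (I : {set 'I_k}) :
  (forall x, exists t, f t != f x) -> (forall x, f (- x) = - f x) ->
  (#|U| <= #|I|.*2.-1)%N ->
  exists2 X : 'I_k -> {set F}, forall i, steerable f (X i) &
    forall x, x \in U -> exists2 i, i \in I & x \in X i.
Proof.
move=> nconst odd_f; move: {2}#|I| (erefl #|I|) => u.
elim: u U I => [|u IH] U I uE; rewrite uE.
  rewrite leqn0 cards_eq0 => /eqP ->.
  exists (fun=> set0) => [i|x]; last by rewrite inE.
  by exists 1, id; split=> [|x]; rewrite ?oner_neq0 ?inE.
move=> /(steerable_peel nconst odd_f)[Y Yst YU].
have [i iI] : exists i, i \in I by apply/set0Pn; rewrite -card_gt0 uE.
have I'u : #|I :\ i| = u by have := uE; rewrite (cardsD1 i) iI => -[].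
have [|X Xst XU] := IH (U :\: Y) (I :\ i) I'u; first by rewrite I'u.
exists (fun j => if j == i then Y else X j) => [j|x xU]; first by case: eqP.
have [xY|xnY] := boolP (x \in Y); first by exists i; rewrite ?eqxx.
have [|j /setD1P[ji jI] xX] := XU x; first by rewrite inE xnY.
by exists j; rewrite ?(negPf ji).
Qed.

(* [a] and [b] need not both lie in [U] when [U] is contained in [{a, -a}]. *)
Lemma target_pair u (U : {set F}) : (#|U| <= u.*2.+1)%N ->
  exists a b, a + b != 0 /\ (#|U :\: [set a; b]| <= u.*2.-1)%N.
Proof.
move=> Uu; have [->|[a aU]] := set_0Vmem U.
  by exists 1, 0; rewrite addr0 oner_neq0 set0D cards0.
have [/exists_inP[b bU /andP[ab nab]]|/exists_inPn nopair] :=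
    boolP [exists b in U, (a != b) && (a + b != 0)].
  exists a, b; split=> //.
  have sub : [set a; b] \subset U by apply/subsetP => z /set2P[] ->.
  by rewrite cardsDS // cards2 ab; lia.
exists a, (if a == 0 then 1 else 0); split.
  by have [->|a0] := eqVneq a 0; rewrite ?add0r ?oner_neq0 ?addr0.
set b := if _ then _ else _.
have sub1 : U :\: [set a; b] \subset U :\ a.
  by apply: setDS; apply/subsetP => z /set1P ->; rewrite set21.
have sub2 : U :\ a \subset [set - a].
  apply/subsetP => z /setD1P[za zU]; have := nopair z zU.
  by rewrite eq_sym za /= negbK addrC addr_eq0 inE.
have := subset_leq_card sub1; have := subset_leq_card sub2.
rewrite cards1; move: Uu.
rewrite (cardsD1 a) aU add1n => Uu U1 /leq_trans; apply.
by case: u Uu => [|u] // _; apply: leq_trans U1 _; rewrite doubleS.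
Qed.

(* Its kernel is the line spanned by [cub a + cub b]. *)
Definition axis a b : G p := (- (a ^+ 2 - a * b + b ^+ 2), 1).

(** On moves the functional is x^3 + c x, whose second difference over 0, 1, 2 is 6, nonzero as p >
    3. *)
Lemma axis_nonconst a b x :
  exists t, lin (axis a b) (cub t) != lin (axis a b) (cub x).
Proof.
apply: contrapT => const.
have {}const t : lin (axis a b) (cub t) = lin (axis a b) (cub x).
  by apply/eqP; apply: contra_notT const; exists t.
have /eqP : 6%:R = 0 :> F.
  have := const 1; rewrite -(const 0) => E1.
  have := const 2%:R; rewrite -(const 0) => E2.
  have -> : 6%:R = (lin (axis a b) (cub 2%:R) - lin (axis a b) (cub 0)) -
    2%:R * (lin (axis a b) (cub 1) - lin (axis a b) (cub 0)) :> F.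
    by rewrite /lin /=; ring.
  by rewrite E1 E2 !subrr mulr0 subr0.
by rewrite (natrM _ 2 3) mulf_eq0 !(negPf (natr_Fp_neq0 _)) //; lia.
Qed.

Lemma axis_odd a b x :
  lin (axis a b) (cub (- x)) = - lin (axis a b) (cub x).
Proof. by rewrite /lin /=; ring. Qed.

(** The second functional is a coordinate on the line, scaled so that [cub a + cub b] counts 1. *)
Lemma axis_inj a b d : a + b != 0 -> lin (axis a b) d = 0 ->
  lin ((a + b)^-1, 0) d = 0 -> d = 0.
Proof.
move=> ab; rewrite /lin /= mul0r addr0 mul1r => E2 /eqP.
rewrite mulf_eq0 invr_eq0 (negPf ab) /= => /eqP E1.
by move: E2; rewrite E1 mulr0 add0r; case: d E1 => d1 d2 /= -> ->.
Qed.

(** As [cub] is odd, both answers change the difference by [cub a + cub b]. *)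
Definition swap a b x := if x == a then - b else if x == b then - a else x.

Lemma axis_swap a b x : lin (axis a b) (cub x - cub (swap a b x)) = 0.
Proof.
rewrite /swap /lin /=; case: eqP => [->|_]; first by ring.
by case: eqP => [->|_]; ring.
Qed.

Lemma swap_neq a b : a + b != 0 -> swap a b a != a /\ swap a b b != b.
Proof.
move=> ab; have nba : - b != a by rewrite eq_sym -addr_eq0.
rewrite /swap eqxx; split=> //; have [ba|_] := eqVneq b a.
  by rewrite {2}ba.
by rewrite eqxx eq_sym -addr_eq0 addrC.
Qed.

Lemma swap_step a b x : a + b != 0 -> swap a b x != x ->
  lin ((a + b)^-1, 0) (cub x - cub (swap a b x)) = 1.
Proof.
move=> ab; rewrite /swap /lin /=; have [-> _|_] := eqVneq x a.
  by rewrite -(mulVf ab); ring.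
have [-> _|_] := eqVneq x b; last by rewrite eqxx.
by rewrite -(mulVf ab); ring.
Qed.

(* The cops in [A] have reached their lines; [U] contains the moves that they do
   not guard. *)
Lemma set_cops_capture k u (U : {set F}) (A : {set 'I_k}) (a b : 'I_k -> F)
    (D : {ffun 'I_k -> G p}) :
  #|~: A| = u -> (#|U| <= u.*2.-1)%N ->
  {in A, forall i, a i + b i != 0} ->
  {in A, forall i, lin (axis (a i) (b i)) (D i) = 0} ->
  (forall x, x \notin U -> exists2 i, i \in A & (x == a i) || (x == b i)) ->
  ~ escapes (S1 p) D.
Proof.
elim: u U A a b D => [|u IH] U A a b D uE Uu abA axA cov esc.
  (* Now all cops are on their lines and all moves are guarded, so steering along the lines ends in
     a capture. *)
  have inA i : i \in A.
    move/eqP: uE; rewrite cards_eq0.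
    by move=> /eqP/setP/(_ i); rewrite !inE => /negbFE.
  have xU x : x \notin U.
    by move: Uu; rewrite leqn0 cards_eq0 => /eqP ->; rewrite inE.
  have [|x|D' esc' [q' [i li]]] := steer (l := fun i => ((a i + b i)^-1, 0))
      (q := fun i => axis (a i) (b i))
      (tau := fun i => swap (a i) (b i)) _ _ esc.
  - by move=> i x /swap_step -> //; rewrite ?axis_swap ?abA.
  - have [i iA /orP[/eqP ->|/eqP ->]] := cov x (xU x); exists i.
      by case: (swap_neq (abA i iA)).
    by case: (swap_neq (abA i iA)).
  have := escapes_neq0 i esc'; have := q' i; rewrite (axA i (inA i)) => qi.
  by rewrite (axis_inj (abA i (inA i)) qi li) eqxx.
have [a0 [b0 [ab0 U'u]]] := target_pair Uu.
have [|X Xst XU] := steerable_cover (U := U) (I := ~: A)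
  (axis_nonconst a0 b0) (axis_odd a0 b0); first by rewrite uE.
have [g] := fin_all_exists Xst; case/fin_all_exists=> t gtP.
(* Dividing by [g i] produces the unit steps required by [steer]. *)
pose l i : G p := if i \in A then ((a i + b i)^-1, 0)
  else (- (a0 ^+ 2 - a0 * b0 + b0 ^+ 2) / g i, (g i)^-1).
have lNA i d : i \notin A -> lin (l i) d = lin (axis a0 b0) d / g i.
  by move=> iA; rewrite /lin /l (negPf iA) /=; ring.
pose q i : G p := if i \in A then axis (a i) (b i) else 0.
pose tau i x := if i \in A then swap (a i) (b i) x
  else if x \in X i then t i x else x.
have [i x|x|D' esc' [q' [i li]]] := @steer k l q tau D _ _ esc.
- rewrite /tau; have [iA|iNA] := boolP (i \in A).
    by rewrite /l /q iA axis_swap => /swap_step ->; rewrite ?abA.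
  case: ifP => [xX _|]; last by rewrite eqxx.
  have [g0 gE] := gtP i.
  by rewrite lNA // linB gE // divff // /q (negPf iNA) lin0l.
- have [xU|/cov[i iA xab]] := boolP (x \in U); last first.
    exists i; rewrite /tau iA; have [neqa neqb] := swap_neq (abA i iA).
    by case/orP: xab => /eqP ->.
  have [i] := XU x xU; rewrite inE => iNA xX; exists i.
  rewrite /tau (negPf iNA) xX; have [g0 gE] := gtP i.
  by apply: contra_neq g0 => tx; rewrite -(gE x xX) tx subrr.
have axA' j : j \in A -> lin (axis (a j) (b j)) (D' j) = 0.
  by move=> jA; have := q' j; rewrite /q jA axA.
(* If cop [i] was already on its line, it has captured the robber; otherwise it has reached the new
   line and joins [A] with the pair [a0], [b0]. *)
have [iA|iNA] := boolP (i \in A).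
  have := escapes_neq0 i esc'; move: li; rewrite /l iA => li.
  by rewrite (axis_inj (abA i iA) (axA' i iA) li) eqxx.
apply: (IH (U :\: [set a0; b0]) (i |: A) (fun j => if j == i then a0 else a j)
  (fun j => if j == i then b0 else b j) D' _ U'u _ _ _ esc').
- by move: uE; rewrite setCU setIC -setDE (cardsD1 i (~: A)) inE iNA => -[].
- move=> j; rewrite !inE; case: eqP => //= _; exact: abA.
- move=> j; rewrite !inE; case: eqP => [-> _|_] /=; last exact: axA'.
  move/eqP: li; rewrite lNA // mulf_eq0 invr_eq0.
  by have [g0 _] := gtP i; rewrite (negPf g0) orbF => /eqP.
move=> x; rewrite !inE negb_and negbK => /orP[xab|/cov[j jA xab]].
  by exists i; rewrite ?eqxx // !inE eqxx.
have ji : j != i by apply: contraNneq iNA => <-.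
by exists j; rewrite ?(negPf ji) // !inE jA orbT.
Qed.

(** * The cop number *)

Lemma cops_win_half : cops_win (Cay (S1 p)) p.+1./2.
Proof.
apply: wins_cops_win S1_0 _ => D; apply: contrapT => nwin.
apply: (@set_cops_capture _ _ [set: F] set0 (fun=> 0) (fun=> 0) D (erefl _)).
(* As p is odd, the p moves number exactly 2u - 1 for u = (p + 1)/2 cops. *)
- rewrite setC0 !cardsT (card_Fp p_prime) card_ord.
  have [|podd] := even_prime p_prime; first by lia.
  by have := odd_double_half p.+1; rewrite oddS podd; lia.
- by move=> i; rewrite inE.
- by move=> i; rewrite inE.
- by move=> x; rewrite inE.
by move=> n; apply/negP => wn; apply: nwin; exists n.
Qed.

Lemma cop_number_half : cop_number (Cay (S1 p)) = p.+1./2.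
Proof.
rewrite /cop_number; case: ex_minnP => n /asboolP win nmin.
apply/eqP; rewrite eqn_leq nmin ?andTb; last exact/asboolP/cops_win_half.
rewrite leqNgt; apply/negP => nlt; apply: not_cops_win win; lia.
Qed.

End Cubic.

Lemma ceil_half_odd (R : realType) (n : nat) : odd n ->
  Num.ceil (n%:R / 2 : R) = (n.+1./2)%:Z.
Proof.
move=> n_odd; apply: ceil_def.
have -> : n%:R = 2 * (n.+1./2)%:R - 1 :> R.
  have nE : n.+1 = (2 * n.+1./2)%N.
    by rewrite mul2n -[LHS]odd_double_half oddS n_odd.
  by rewrite -natrM -nE -natr1 addrK.
rewrite rmorphB /=; apply/andP; split; lra.
Qed.

Theorem theorem5p1 (R : realType) (p : nat) (p_prime : prime p)
    (p_gt3 : (3 < p)%N) :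
  (cop_number (Cay (S1 p)))%:Z = Num.ceil (p%:R / 2 : R) /\
  Num.ceil (p%:R / 2 : R) =
    Num.ceil (Num.sqrt (#|G p|%:R : R) / 2).
Proof.
have p_odd : odd p by case: (even_prime p_prime) => // p2; rewrite p2 in p_gt3.
split; first by rewrite cop_number_half // ceil_half_odd.
by rewrite card_prod !card_Fp // natrM -expr2 sqrtr_sqr ger0_norm.
Qed.
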